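(* Let $X_1,X_2,\dots$ be independent and identically distributed real random variables with $E[X_1]=0$, $0<\sigma^2:=E[X_1^2]$ (with $\sigma>0$) and $\xi:=E|X_1|^3<\infty$. Let $\lambda>0$ and let $N\sim\mathrm{Poisson}(\lambda)$ be independent of the sequence $(X_j)_{j\ge1}$. Put $W:=\lambda^{-1/2}\sum_{j=1}^NX_j$. Then $$d_{\mathcal W}\bigl(\mathcal L(W),N(0,\sigma^2)\bigr)\le\Bigl(\frac{C_{\mathcal W}\,\xi}{\sigma^2}+\sigma\sqrt{\frac2\pi}\Bigr)\frac1{\sqrt\lambda}.$$
   Context: $\mathcal L(Y)$ denotes the distribution of a random variable $Y$; an empty sum is $0$. $d_{\mathcal W}(\mu,\nu):=\sup_h|\int h\,d\mu-\int h\,d\nu|$, the supremum over all $1$-Lipschitz $h:\mathbb R\to\mathbb R$, is the Wasserstein distance of probability measures on $\mathbb R$ with finite first moment. $C_{\mathcal W}$ is a finite absolute constant in the Wasserstein version of the Berry-Esseen theorem, i.e. a constant such that for all $n\ge1$ and all independent random variables $Y_1,\dots,Y_n$ with $E[Y_j]=0$, $E[Y_j^2]>0$, $E|Y_j|^3<\infty$, writing $B_n^2=\sum_{j=1}^nE[Y_j^2]$, one has $d_{\mathcal W}\bigl(\mathcal L(B_n^{-1}\sum_{j=1}^nY_j),N(0,1)\bigr)\le C_{\mathcal W}B_n^{-3}\sum_{j=1}^nE|Y_j|^3$. *)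

(* Defs.v *)
From HB Require Import structures.
From mathcomp Require Import all_boot all_order all_algebra finmap.
From mathcomp Require Import all_classical all_reals all_analysis.
From mathcomp Require Import measurable_realfun.
Set Implicit Arguments.
Unset Strict Implicit.
Unset Printing Implicit Defensive.
Import Order.TTheory GRing.Theory Num.Theory.
Import numFieldNormedType.Exports.

Local Open Scope classical_set_scope.
Local Open Scope ring_scope.

(* The integrals are extended-real valued and the supremum is taken in \bar R.
   If mu and nu have finite first moments, then every 1-Lipschitz h is
   integrable and this is the usual distance.  If exactly one of them has a
   finite first moment, then h := `|x| gives the value +oo, so that a finite
   bound on the distance to a normal law implies a finite first moment. *)
Definition wasserstein (R : realType) (mu nu : probability R R) : \bar R :=
  ereal_sup [set `|\int[mu]_x (h x)%:E - \int[nu]_x (h x)%:E|%E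
            | h in [set h : R -> R | 1.-lipschitz_setT h]].

(* [normal_prob m s] (standard deviation [s]) is a measure on
   [measurableTypeR R], whose measure display differs from the one of [R],
   where the distributions of real random variables live.  This is the same
   set function, retyped. *)
Definition normal_law (R : realType) (m s : R) : set R -> \bar R :=
  normal_prob m s.

Section normal_law.
Context (R : realType) (m s : R).

Let normal_law0 : normal_law m s set0 = 0%E.
Proof. exact: (@measure0 _ _ _ (@normal_prob R m s)). Qed.

Let normal_law_ge0 A : (0 <= normal_law m s A)%E.
Proof. exact: (@measure_ge0 _ _ _ (@normal_prob R m s)). Qed.

Let normal_law_sigma_additive : semi_sigma_additive (normal_law m s).
Proof. exact: (@measure_semi_sigma_additive _ _ _ (@normal_prob R m s)). Qed.

HB.instance Definition _ := isMeasure.Build _ _ _ (normal_law m s)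
  normal_law0 normal_law_ge0 normal_law_sigma_additive.

Let normal_law_setT : normal_law m s [set: R] = 1%E.
Proof. exact: (@probability_setT _ _ _ (@normal_prob R m s)). Qed.

HB.instance Definition _ := @Measure_isProbability.Build _ _ R
  (normal_law m s) normal_law_setT.

End normal_law.

Section independence.
Context d (T : measurableType d) (R : realType) (P : probability T R).

Definition mutually_independent (I : choiceType) d' (T' : measurableType d')
    (X : I -> {RV P >-> T'}) : Prop :=
  forall (J : {fset I}) (A : I -> set T'),
    (forall i, i \in J -> measurable (A i)) ->
    P (\bigcap_(i in [set` J]) (X i @^-1` A i)) =
    (\prod_(i <- J) fine (P (X i @^-1` A i)))%:E.

Definition sigma_family (I : Type) d' (T' : measurableType d')
    (X : I -> {RV P >-> T'}) : set (set T) :=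
  <<s \bigcup_i preimage_set_system [set: T] (X i) measurable >>.

Definition independent_of_family (I : Type) d1 (T1 : measurableType d1)
    d2 (T2 : measurableType d2)
    (N : {RV P >-> T1}) (X : I -> {RV P >-> T2}) : Prop :=
  forall (B : set T1) (E : set T), measurable B -> sigma_family X E ->
    P (N @^-1` B `&` E) = (P (N @^-1` B) * P E)%E.

(* Only measurable sets are compared: [distribution P Y] is a total function
   on [set T'], whose values on nonmeasurable sets are meaningless. *)
Definition identically_distributed (I : Type) d' (T' : measurableType d')
    (X : I -> {RV P >-> T'}) : Prop :=
  forall (i j : I) (A : set T'), measurable A ->
    distribution P (X i) A = distribution P (X j) A.

End independence.

Section sums.
Context d (T : measurableType d) (R : realType).

Definition scaled_sum (c : R) (n : nat) (Y : 'I_n -> {mfun T >-> R}) : T -> R :=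
  fun t => c * \sum_(j < n) Y j t.

Lemma measurable_scaled_sum (c : R) (n : nat) (Y : 'I_n -> {mfun T >-> R}) :
  measurable_fun [set: T] (scaled_sum c Y).
Proof.
apply: measurable_funM; first exact: measurable_cst.
by apply: measurable_sum => j; exact: measurable_funPT.
Qed.

HB.instance Definition _ (c : R) (n : nat) (Y : 'I_n -> {mfun T >-> R}) :=
  isMeasurableFun.Build _ _ _ _ (scaled_sum c Y) (measurable_scaled_sum c Y).

(* The sequence X_1, X_2, ... is indexed from 0: X_j is [X j.-1]. *)
Definition scaled_random_sum (c : R) (N : {mfun T >-> nat})
    (X : nat -> {mfun T >-> R}) : T -> R :=
  fun t => c * \sum_(j < N t) X j t.

Lemma measurable_scaled_random_sum (c : R) (N : {mfun T >-> nat})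
    (X : nat -> {mfun T >-> R}) :
  measurable_fun [set: T] (scaled_random_sum c N X).
Proof.
apply: measurable_funM; first exact: measurable_cst.
move=> _ B mB; rewrite setTI.
have -> : (fun t => \sum_(j < N t) X j t) @^-1` B =
    \bigcup_n (N @^-1` [set n] `&`
               ((fun t => \sum_(j < n) X j t) @^-1` B)).
  apply/seteqP; split => [t Bt|t [n _ [/= <-]]//].
  by exists (N t).
apply: bigcup_measurable => n _; apply: measurableI.
  exact: measurable_funPTI.
rewrite -[X in measurable X]setTI.
have : measurable_fun [set: T] (fun t => \sum_(j < n) X j t).
  by apply: measurable_sum => j; exact: measurable_funPT.
exact.
Qed.

HB.instance Definition _ (c : R) (N : {mfun T >-> nat})
    (X : nat -> {mfun T >-> R}) :=
  isMeasurableFun.Build _ _ _ _ (scaled_random_sum c N X)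
    (measurable_scaled_random_sum c N X).

End sums.

(* [C] is an admissible constant in the Wasserstein version of the
   Berry-Esseen theorem, uniformly over all probability spaces. *)
Definition wasserstein_berry_esseen_constant (R : realType) (C : R) : Prop :=
  forall (n : nat) d (T : measurableType d) (P : probability T R)
         (Y : 'I_n -> {RV P >-> R}),
    (1 <= n)%N ->
    mutually_independent Y ->
    (forall j, 'E_P[Y j] = 0)%E ->
    (forall j, 0 < 'E_P[fun t => (Y j t ^+ 2)%R])%E ->
    (forall j, 'E_P[fun t => (`|Y j t| ^+ 3)%R] < +oo)%E ->
    let B : R := Num.sqrt (\sum_(j < n) fine 'E_P[fun t => Y j t ^+ 2]) in
    (wasserstein (distribution P (scaled_sum B^-1 Y)) (normal_law 0 1) <=
      (C * B ^- 3 * \sum_(j < n) fine 'E_P[fun t => (`|Y j t| ^+ 3)%R])%:E)%E.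

(* Main.v *)
From HB Require Import structures.
From mathcomp Require Import all_boot all_order all_algebra finmap.
From mathcomp Require Import all_classical all_reals all_analysis.
From mathcomp Require Import measurable_realfun ring lra.
Require Import Defs.
Import Order.TTheory GRing.Theory Num.Theory.
Import numFieldNormedType.Exports.
Local Open Scope classical_set_scope.
Local Open Scope ring_scope.

(** Condition on the number of summands.  As [N] is independent of the sequence,
    the law of [W] is the Poisson mixture of the laws of the scaled partial sums
    [S_n / sqrt lambda] ([distribution_random_sum]), and the Wasserstein distance
    to a fixed law is convex ([wasserstein_mixture]).  It is therefore enough to
    bound, for each [n], the distance from [S_n / sqrt lambda] to
    [N(0, sigma ^ 2)] and to average the bounds over the Poisson weights.

    For each [n] the normal law [N(0, sigma ^ 2 n / lambda)], which has the
    variance of [S_n / sqrt lambda], is inserted ([wasserstein_partial_sum]).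
    The Berry-Esseen bound for [S_n / (sigma sqrt n)], namely
    [CW xi / (sigma ^ 3 sqrt n)], is multiplied by [sigma sqrt (n / lambda)] under
    rescaling ([wasserstein_dilation]) and becomes
    [CW xi / (sigma ^ 2 sqrt lambda)], whatever [n] is.  The two centred normal
    laws are the laws of multiples of one standard normal variable [Z], so their
    distance is at most [sigma |sqrt (n / lambda) - 1| E |Z|]
    ([wasserstein_dilation_dist]), where [E |Z| = sqrt (2 / pi)].

    Finally [|sqrt y - 1| <= |y - 1|] for [y >= 0], and the mean of
    [|N / lambda - 1|] is at most [1 / sqrt lambda] because the variance of [N] is
    [lambda] ([poisson_sqrt_deviation]). *)

Set Implicit Arguments.
Unset Strict Implicit.
Unset Printing Implicit Defensive.

(** * 1-Lipschitz functions *)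

Lemma lipschitz1P (R : realType) (h : R -> R) :
  1.-lipschitz_setT h <-> forall x y, `|h x - h y| <= `|x - y|.
Proof.
split=> [hl x y|hl [x y] _ /=]; last by rewrite mul1r.
by have := hl (x, y) (conj I I); rewrite /= mul1r.
Qed.

Lemma lipschitz1_measurable (R : realType) (h : R -> R) :
  1.-lipschitz_setT h -> measurable_fun setT h.
Proof.
move=> /lipschitz1P hl; apply: continuous_measurable_fun => x.
apply/cvgrPdist_le => e e0; by exists e => //= y /ltW; exact/le_trans/hl.
Qed.

(** * Laws on the line and the Wasserstein distance *)

Section dilation.
Context (R : realType).

(** The image of a law by [dilation c] is the law of [c] times a random variable
    with that law: normal laws and normalised sums of different scales are all
    compared through such images. *)
Definition dilation (c : R) : R -> R := fun x => c * x.

Lemma measurable_dilation c : measurable_fun setT (dilation c).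
Proof. exact: measurable_funM. Qed.
HB.instance Definition _ c := isMeasurableFun.Build _ _ _ _ (dilation c)
  (measurable_dilation c).

End dilation.

Section wasserstein_theory.
Context (R : realType).
Implicit Types mu nu rho : probability R R.
Local Open Scope ereal_scope.

Definition first_moment mu : \bar R := \int[mu]_x `|x|%:E.

Lemma linear_growth_integrable mu (f : R -> R) (a b : R) :
  first_moment mu < +oo -> measurable_fun setT f -> (0 <= b)%R ->
  (forall x, `|f x| <= a + b * `|x|)%R -> mu.-integrable setT (EFin \o f).
Proof.
move=> mu1 mf b0 fab.
apply: (@le_integrable _ _ _ mu _ _ _ (EFin \o (fun x => a + b * `|x|)%R)) => //.
- exact/measurable_EFinP.
- by move=> x _; rewrite lee_fin (le_trans (fab x))// ler_norm.
- rewrite (_ : _ \o _ = (EFin \o cst a) \+ (fun x : R => b%:E * `|x|%:E))//.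
  apply: integrableD => //; first exact: finite_measure_integrable_cst.
  apply: integrableZl => //; apply/integrableP; split; first exact/measurable_EFinP.
  by under eq_integral do rewrite /= normr_id.
Qed.

Lemma lipschitz1_dilation_integrable mu (h : R -> R) (c : R) : first_moment mu < +oo ->
  1.-lipschitz_setT h -> mu.-integrable setT (fun x => (h (c * x)%R)%:E).
Proof.
move=> mu1 hl; have mh := lipschitz1_measurable hl.
apply: (@linear_growth_integrable _ (h \o *%R c) `|h 0%R| `|c|%R) => //.
  exact: measurableT_comp.
move=> x /=; move/lipschitz1P : hl => /(_ (c * x) 0)%R; rewrite subr0 normrM.
by have := ler_normD (h (c * x) - h 0)%R (h 0)%R; rewrite subrK; lra.
Qed.

Lemma lipschitz1_integrable mu (h : R -> R) : first_moment mu < +oo ->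
  1.-lipschitz_setT h -> mu.-integrable setT (EFin \o h).
Proof.
move=> mu1 hl; have := lipschitz1_dilation_integrable 1 mu1 hl.
by under eq_fun do rewrite mul1r.
Qed.

(** The absolute value is an admissible test function.  Thus a finite distance to
    a law with a first moment gives a first moment for free, which is how the
    integrability of the normalised sums follows from the Berry-Esseen bound. *)
Lemma first_moment_lty mu nu : first_moment nu < +oo ->
  wasserstein mu nu < +oo -> first_moment mu < +oo.
Proof.
move=> nufin; apply: contraTT; rewrite -!leNgt !leye_eq => /eqP mu_oo.
apply/eqP/eq_infty => r.
apply: (@le_trans _ _ (`|first_moment mu - first_moment nu|)).
  rewrite mu_oo addye; last by rewrite eqe_oppLR lt_eqF.
  by rewrite leey.
apply: ereal_sup_ubound; exists (fun x => `|x|%R) => //.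
by apply/lipschitz1P => x y; exact: ler_dist_dist.
Qed.

Lemma eq_wasserstein mu nu mu' nu' :
  (forall A, measurable A -> mu A = mu' A) ->
  (forall A, measurable A -> nu A = nu' A) ->
  wasserstein mu nu = wasserstein mu' nu'.
Proof.
move=> mumu' nunu'; congr ereal_sup; apply: eq_imagel => h _.
have -> : \int[mu]_x (h x)%:E = \int[mu']_x (h x)%:E.
  by apply: eq_measure_integral => A mA _; exact: mumu'.
have -> // : \int[nu]_x (h x)%:E = \int[nu']_x (h x)%:E.
by apply: eq_measure_integral => A mA _; exact: nunu'.
Qed.

(** The first moments keep the three integrals finite, so that the middle one can
    be subtracted and added back. *)
Lemma wasserstein_triangle mu nu rho : first_moment mu < +oo ->
  first_moment nu < +oo -> first_moment rho < +oo ->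
  wasserstein mu rho <= wasserstein mu nu + wasserstein nu rho.
Proof.
move=> mu1 nu1 rho1; apply: ge_ereal_sup => _ [h hl <-].
have inte m : first_moment m < +oo -> \int[m]_x (h x)%:E \is a fin_num.
  by move=> m1; apply: integrable_fin_num => //; exact: lipschitz1_integrable.
have -> : \int[mu]_x (h x)%:E - \int[rho]_x (h x)%:E =
  (\int[mu]_x (h x)%:E - \int[nu]_x (h x)%:E) +
  (\int[nu]_x (h x)%:E - \int[rho]_x (h x)%:E).
  by rewrite addeA subeK// inte.
apply: (le_trans (lee_abs_add _ _)).
by apply: leeD; apply: ereal_sup_ubound; exists h.
Qed.

Lemma integral_dilation mu c (h : R -> R) : measurable_fun setT h ->
  mu.-integrable setT (fun x => (h (c * x))%:E) ->
  \int[distribution mu (dilation c)]_x (h x)%:E = \int[mu]_x (h (c * x))%:E.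
Proof.
move=> mh ih; rewrite (@integral_distribution _ _ _ _ _ _ (dilation c) (EFin \o h))//.
exact/measurable_EFinP.
Qed.

Lemma first_moment_dilation mu c :
  first_moment (distribution mu (dilation c)) = `|c|%:E * first_moment mu.
Proof.
rewrite /first_moment (@ge0_integral_distribution _ _ _ _ _ _ (dilation c)
  (fun x : R => `|x|%:E))//; last exact/measurable_EFinP.
rewrite -ge0_integralZl//; last exact/measurable_EFinP.
by apply: eq_integral => x _; rewrite /= normrM EFinM.
Qed.

(** If [h] is 1-Lipschitz then so is [x => h (c x) / c]. *)
Lemma wasserstein_dilation mu nu c : (0 < c)%R ->
  first_moment mu < +oo -> first_moment nu < +oo ->
  wasserstein (distribution mu (dilation c)) (distribution nu (dilation c)) <=
  c%:E * wasserstein mu nu.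
Proof.
move=> c0 mu1 nu1; apply: ge_ereal_sup => _ [h hl <-].
pose g x := (c^-1 * h (c * x))%R.
have gl : 1.-lipschitz_setT g.
  apply/lipschitz1P => x y; rewrite /g -mulrBr normrM gtr0_norm ?invr_gt0//.
  rewrite ler_pdivrMl//; move/lipschitz1P : hl => /(_ (c * x) (c * y))%R.
  by rewrite -mulrBr normrM (gtr0_norm c0).
have inteE m : first_moment m < +oo ->
    \int[distribution m (dilation c)]_x (h x)%:E = c%:E * \int[m]_x (g x)%:E.
  move=> m1; have ig := lipschitz1_integrable m1 gl.
  have hE : (fun x => (h (c * x))%:E) = (fun x => c%:E * (EFin \o g) x).
    by apply/funext => x; rewrite /= -EFinM /g mulVKf// gt_eqF.
  rewrite integral_dilation ?hE ?integralZl//; first exact: lipschitz1_measurable.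
  exact: integrableZl.
rewrite !inteE// -muleBr//; last first.
  by rewrite fin_num_adde_defl// fin_numN integrable_fin_num//;
    exact: lipschitz1_integrable.
rewrite abseM gee0_abs ?lee_fin; last exact: ltW.
apply: lee_wpmul2l; first by rewrite lee_fin ltW.
by apply: ereal_sup_ubound; exists g.
Qed.

(** The coupling [(a Z, b Z)] of the two laws costs [E |a Z - b Z|]. *)
Lemma wasserstein_dilation_dist mu a b : first_moment mu < +oo ->
  wasserstein (distribution mu (dilation a)) (distribution mu (dilation b)) <=
  `|a - b|%:E * first_moment mu.
Proof.
move=> mu1; apply: ge_ereal_sup => _ [h hl <-].
have mh := lipschitz1_measurable hl.
have ih c := lipschitz1_dilation_integrable c mu1 hl.
rewrite !integral_dilation// -integralB//.
apply: (le_trans (le_abse_integral _ _ _)) => //.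
  by apply: emeasurable_funB; exact: (measurable_int mu).
rewrite -ge0_integralZl//; last exact/measurable_EFinP.
apply: ge0_le_integral => //.
- by apply: measurableT_comp => //; apply: emeasurable_funB; exact: (measurable_int mu).
- by apply/measurable_EFinP; apply: measurable_funM.
- move=> x _ /=; rewrite lee_fin -normrM mulrBl.
  by move/lipschitz1P : hl; apply.
Qed.

End wasserstein_theory.

(** * The normal law: scaling and first moment *)

Section gaussian.
Context (R : realType).
Local Notation leb := (@lebesgue_measure R).

(** Both sides are measures that agree on half-open intervals. *)
Lemma lebesgue_measure_dilation (s : R) (A : set R) : 0 < s -> measurable A ->
  leb A = (s%:E * leb (dilation s @^-1` A))%E.
Proof.
move=> s0 mA.
have mf : measurable_fun [set: R] (dilation s : _ -> measurableTypeR R).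
  exact: measurable_dilation.
rewrite (@lebesgue_measure_unique _ (mscale (NngNum (ltW s0)) (pushforward leb (dilation s : _ -> measurableTypeR R))))//.
move=> _ [[a b]] _ <-.
transitivity (s%:E * leb (dilation s @^-1` `]a, b]))%E; last by [].
have -> : dilation s @^-1` `]a, b] = `]a / s, b / s]%classic.
  apply/seteqP; split => x /=; rewrite !in_itv/= /dilation;
    by rewrite ltr_pdivrMr// ler_pdivlMr// [s * x]mulrC.
rewrite !lebesgue_measure_itv/= !lte_fin ltr_pM2r ?invr_gt0//.
case: ifP => _; last by rewrite mule0.
by rewrite -!EFinB -EFinM mulrBr !(mulrCA s) mulfV ?mulr1// gt_eqF.
Qed.

Lemma normal_pdf_dilation (s x : R) : 0 < s ->
  s * normal_pdf 0 s (s * x) = normal_pdf 0 1 x.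
Proof.
move=> s0; rewrite !normal_pdfE ?oner_eq0 ?gt_eqF// /normal_peak /normal_fun.
rewrite !subr0 expr1n mul1r -mulrnAr sqrtrM ?sqr_ge0// sqrtr_sqr gtr0_norm//.
rewrite invfM -[in LHS]mulrA mulVKf ?gt_eqF//.
congr (_ * expR _).
have s0' : s != 0 by rewrite gt_eqF.
by field.
Qed.

Lemma normal_law_dilation (s : R) (A : set R) : 0 < s -> measurable A ->
  normal_law 0 s A = distribution (normal_law 0 1) (dilation s) A.
Proof.
move=> s0 mA; rewrite /distribution /pushforward /normal_law /normal_prob.
have mf : measurable_fun [set: R] (dilation s : _ -> measurableTypeR R).
  exact: measurable_dilation.
rewrite (eq_measure_integral (mscale (NngNum (ltW s0)) (pushforward leb (dilation s : _ -> measurableTypeR R)))).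
  rewrite ge0_integral_mscale//; last first.
  - by move=> x _; rewrite lee_fin normal_pdf_ge0.
  - by apply/measurable_EFinP; apply: measurable_funTS; exact: measurable_normal_pdf.
  rewrite ge0_integral_pushforward//; last first.
  - by move=> x _; rewrite lee_fin normal_pdf_ge0.
  - by apply/measurable_EFinP; apply: measurable_funTS; exact: measurable_normal_pdf.
  rewrite -ge0_integralZl//; last first.
  - by move=> x _; rewrite lee_fin normal_pdf_ge0.
  - apply/measurable_EFinP; apply: measurable_funTS.
    by apply: measurableT_comp => //; exact: measurable_normal_pdf.
  - by rewrite -[X in measurable X]setTI; exact: mf.
  by apply: eq_integral => x _; rewrite /= -EFinM normal_pdf_dilation.
by move=> B mB _; exact: lebesgue_measure_dilation.
Qed.

(** The density of a normal law is its Radon-Nikodym derivative up to a null set,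
    and [normal_law] is the image of [normal_prob] by the identity between two
    presentations of the Borel line. *)
Lemma ge0_integral_normal_law (s : R) (f : R -> \bar R) :
  measurable_fun setT f -> (forall x, 0 <= f x)%E ->
  (\int[normal_law 0 s]_x f x = \int[leb]_x (f x * (normal_pdf 0 s x)%:E))%E.
Proof.
move=> mf f0.
have dom := normal_prob_dominates 0 s.
transitivity (\int[normal_prob 0 s]_x f x)%E.
  exact: (@ge0_integral_pushforward _ _ (measurableTypeR R) R R idfun
    (@measurable_id _ _ setT) (normal_prob 0 s) setT f).
rewrite -(Radon_Nikodym_SigmaFinite.change_of_variables dom)//.
have ig := Radon_Nikodym_SigmaFinite.f_integrable dom.
apply: ae_eq_integral => //.
- by apply: emeasurable_funM => //; exact: (measurable_int leb).
- by apply: emeasurable_funM => //; apply/measurable_EFinP; exact: measurable_normal_pdf.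
- apply: ae_eqe_mul2l; apply: integral_ae_eq => //.
  + by apply/measurable_EFinP; exact: measurable_normal_pdf.
  + by move=> E _ mE; rewrite -Radon_Nikodym_SigmaFinite.f_integral.
Qed.

(** By parity this is twice the integral of [x * phi x] over the half-line, and
    [- phi] is a primitive of that integrand. *)
Lemma first_moment_std_normal :
  first_moment (normal_law (0 : R) 1) = (Num.sqrt (2 / pi))%:E.
Proof.
rewrite /first_moment ge0_integral_normal_law//; last first.
  exact/measurable_EFinP.
have pdfE (x : R) : normal_pdf 0 1 x = normal_peak 1 * expR (- x ^+ 2 / 2).
  by rewrite normal_pdfE ?oner_eq0// /normal_fun subr0 expr1n.
under eq_integral do rewrite -EFinM.
rewrite ge0_symfun_integralT; last first.
- by move=> x /=; rewrite !pdfE normrN sqrrN.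
- move=> x; apply: continuousM; first exact: norm_continuous.
  by apply: continuous_normal_pdf; rewrite oner_eq0.
- by move=> x; rewrite mulr_ge0 ?normal_pdf_ge0.
rewrite -set_itvcy.
under eq_integral => x.
  rewrite inE/= in_itv/= andbT => x0; rewrite ger0_norm//; over.
have cpdf : continuous (normal_pdf (0:R) 1).
  by apply: continuous_normal_pdf; rewrite oner_eq0.
have dF (x : R) : is_derive x 1 (fun x => - normal_pdf 0 1 x) (x * normal_pdf 0 1 x).
  have -> : (fun x => - normal_pdf 0 1 x) =
      (fun x : R => (- normal_peak 1) * (expR \o (fun z : R => - 2^-1 * (z * z))) x).
    apply/funext => z; rewrite pdfE /= [RHS]mulNr; congr (- (_ * expR _)).
    by field.
  have d1 : is_derive x 1 (fun z : R => - 2^-1 * (z * z)) (- x).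
    by apply: is_derive_eq; rewrite -![_ *: _]/(_ * _); field.
  apply: is_derive_eq; rewrite pdfE -![_ *: _]/(_ * _).
  rewrite (_ : - 2^-1 * (x * x) = - x ^+ 2 / 2); [by ring|by field].
rewrite (@ge0_continuous_FTC2y _ _ (fun x => - normal_pdf 0 1 x) 0 0).
- rewrite pdfE expr0n /= oppr0 mul0r expR0 mulr1 opprK add0e -EFinM; congr EFin.
  have -> : 2 / pi = 2 ^+ 2 * (pi *+ 2)^-1 :> R.
    by rewrite -[pi *+ 2]mulr_natr invfM mulrCA expr2 mulfK// mulrC.
  rewrite /normal_peak expr1n mul1r.
  rewrite sqrtrM ?sqr_ge0// sqrtr_sqr ger0_norm// sqrtrV//.
  by rewrite mulrn_wge0// pi_ge0.
- by move=> x x0; rewrite mulr_ge0// normal_pdf_ge0.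
- apply: continuous_subspaceT => x; apply: continuousM => //.
  exact: cpdf.
- have -> : (fun x => - normal_pdf 0 1 x) =
      (fun x : R => (- normal_peak 1) * expR (- (x ^+ 2 / 2))).
    by apply/funext => z; rewrite pdfE [RHS]mulNr mulNr.
  rewrite -[X in _ --> X](mulr0 (- normal_peak 1)); apply: cvgMl_tmp.
  apply: (cvg_comp (fun x : R => x ^+ 2 / 2) (fun x => expR (- x))); last exact: cvgr_expR.
  apply/gt0_cvgMly; last exact: cvgr_expr2.
  by rewrite invr_gt0.
- by move=> x _; exact: ex_derive.
- apply: cvg_at_right_filter; apply: continuousN; exact: cpdf.
- by move=> x _; rewrite derive1E derive_val.
Qed.
End gaussian.

(** * Convexity: distance from a mixture to a fixed law *)

Section mixture.
Context (R : realType) (p : nat -> R) (mu_ : nat -> probability R R)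
  (mu nu : probability R R).
Hypothesis p0 : forall n, 0 <= p n.
Hypothesis p1 : (\sum_(n <oo) (p n)%:E = 1)%E.
Hypothesis muE : forall A, measurable A ->
  mu A = (\sum_(n <oo) (p n)%:E * mu_ n A)%E.
Local Open Scope ereal_scope.

Lemma ge0_integral_mixture (f : R -> \bar R) :
  measurable_fun setT f -> (forall x, 0 <= f x) ->
  \int[mu]_x f x = \sum_(n <oo) (p n)%:E * \int[mu_ n]_x f x.
Proof.
move=> mf f0.
rewrite (eq_measure_integral (mseries (fun n => mscale (NngNum (p0 n)) (mu_ n)) 0)).
  rewrite ge0_integral_measure_series//; apply: eq_eseriesr => n _.
  by rewrite ge0_integral_mscale.
by move=> A mA _; exact: muE.
Qed.

Lemma nneseries_weightedC (c : R) : \sum_(n <oo) (p n)%:E * c%:E = c%:E.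
Proof.
under eq_eseriesr do rewrite muleC.
by rewrite nneseriesZl ?p1 ?mule1// => n _; rewrite lee_fin.
Qed.

(** A termwise inequality between averages, arranged without subtractions so that
    it holds for series of extended nonnegative numbers. *)
Lemma nneseries_weighted_le (a b : nat -> \bar R) (r : nat -> R) (c e : R) :
  (forall n, 0 <= a n) -> (forall n, 0 <= b n) -> (forall n, 0 <= r n)%R ->
  (0 <= c)%R -> (0 <= e)%R ->
  (forall n, a n + c%:E <= b n + e%:E + (r n)%:E) ->
  \sum_(n <oo) (p n)%:E * a n + c%:E <=
  \sum_(n <oo) (p n)%:E * b n + e%:E + \sum_(n <oo) (p n * r n)%:E.
Proof.
move=> a0 b0 r0 c0 e0 abr.
have pM x n : 0 <= x -> 0 <= (p n)%:E * x by move=> ?; rewrite mule_ge0// lee_fin.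
rewrite -[X in _ + X <= _]nneseries_weightedC.
rewrite -[X in _ + X + _]nneseries_weightedC.
rewrite -!nneseriesD; first last; try by
  [move=> n _ _; rewrite ?adde_ge0// ?pM ?lee_fin// mulr_ge0].
apply: lee_nneseries => [n _ _|n _]; first by rewrite adde_ge0 ?pM ?lee_fin.
rewrite EFinM -!ge0_muleDr ?adde_ge0 ?lee_fin//.
by apply: lee_wpmul2l => //; rewrite lee_fin.
Qed.

Let parts_fin_num (m : probability R R) (h : R -> R) :
  first_moment m < +oo -> 1.-lipschitz_setT h ->
  \int[m]_x (EFin \o h)^\+ x \is a fin_num /\
  \int[m]_x (EFin \o h)^\- x \is a fin_num.
Proof.
move=> m1 hl; have ih := lipschitz1_integrable m1 hl.
by split; [exact: integrable_pos_fin_num|exact: integrable_neg_fin_num].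
Qed.

(** Positive and negative parts are kept on opposite sides: the first moment of
    [mu] is not yet known to be finite. *)
Let mixture_le (b : nat -> R) (h : R -> R) :
  first_moment nu < +oo -> 1.-lipschitz_setT h ->
  (forall n, 0 <= b n)%R ->
  (forall n, wasserstein (mu_ n) nu <= (b n)%:E) ->
  \int[mu]_x (EFin \o h)^\+ x + \int[nu]_x (EFin \o h)^\- x <=
  \int[mu]_x (EFin \o h)^\- x + \int[nu]_x (EFin \o h)^\+ x +
    \sum_(n <oo) (p n * b n)%:E.
Proof.
move=> nu1 hl b0 Wb.
have mh : measurable_fun setT (EFin \o h).
  by apply/measurable_EFinP; exact: lipschitz1_measurable.
rewrite ge0_integral_mixture//; last exact: measurable_funepos.
rewrite ge0_integral_mixture//; last exact: measurable_funeneg.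
have [nup nun] := parts_fin_num nu1 hl.
rewrite -(fineK nup) -(fineK nun).
apply: nneseries_weighted_le => //; try by [move=> n; exact: integral_ge0].
- by apply: fine_ge0; exact: integral_ge0.
- by apply: fine_ge0; exact: integral_ge0.
move=> n; have mun1 : first_moment (mu_ n) < +oo.
  by apply: (first_moment_lty nu1); rewrite (le_lt_trans (Wb n))// ltry.
have : `|\int[mu_ n]_x (h x)%:E - \int[nu]_x (h x)%:E| <= (b n)%:E.
  by apply: le_trans (Wb n); apply: ereal_sup_ubound; exists h.
have [mup mun] := parts_fin_num mun1 hl.
rewrite (integralE (mu_ n)) (integralE nu).
rewrite -(fineK mup) -(fineK mun) -(fineK nup) -(fineK nun).
by rewrite -!EFinB /= !lee_fin => /ler_normlW; lra.
Qed.

(** The distance to [nu] is convex.  The inequality of [mixture_le] is used three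
    times: with the absolute value, which gives [mu] a first moment, and then
    with [h] and [- h], which bound the difference of integrals on both sides. *)
Lemma wasserstein_mixture (b : nat -> R) : (forall n, 0 <= b n)%R ->
  first_moment nu < +oo ->
  (forall n, wasserstein (mu_ n) nu <= (b n)%:E) ->
  wasserstein mu nu <= \sum_(n <oo) (p n * b n)%:E.
Proof.
move=> b0 nu1 Wb; have [->|] := eqVneq (\sum_(n <oo) (p n * b n)%:E) +oo.
  by rewrite leey.
rewrite -ltey => bfin.
have sb0 : 0 <= \sum_(n <oo) (p n * b n)%:E.
  by apply: nneseries_ge0 => n _ _; rewrite lee_fin mulr_ge0.
have mu1 : first_moment mu < +oo.
  have nl : 1.-lipschitz_setT (fun x : R => `|x|%R).
    by apply/lipschitz1P => x y; exact: ler_dist_dist.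
  have := mixture_le nu1 nl b0 Wb.
  have -> : (EFin \o (fun x : R => `|x|%R))^\- = cst 0.
    by apply/funext => x; rewrite funenegE/= max_r// lee_fin oppr_le0.
  have -> : (EFin \o (fun x : R => `|x|%R))^\+ = fun x : R => `|x|%:E.
    by apply/funext => x; rewrite funeposE/= max_l// lee_fin.
  rewrite !integral_cst// !mul0e adde0 add0e => /le_lt_trans; apply.
  exact: lte_add_pinfty.
apply: ge_ereal_sup => _ [h hl <-].
have Nhl : 1.-lipschitz_setT (-%R \o h).
  by apply/lipschitz1P => x y /=; rewrite -opprD normrN; move/lipschitz1P : hl; apply.
have := mixture_le nu1 hl b0 Wb; have := mixture_le nu1 Nhl b0 Wb.
rewrite (_ : EFin \o (-%R \o h) = \- (EFin \o h))//.
rewrite funeposN funenegN.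
have iE (m : probability R R) : \int[m]_x (h x)%:E =
    \int[m]_x (EFin \o h)^\+ x - \int[m]_x (EFin \o h)^\- x by rewrite integralE.
rewrite (iE mu) (iE nu).
have [mup mun] := parts_fin_num mu1 hl; have [nup nun] := parts_fin_num nu1 hl.
have sfin : \sum_(n <oo) (p n * b n)%:E \is a fin_num by rewrite ge0_fin_numE.
rewrite -(fineK mup) -(fineK mun) -(fineK nup) -(fineK nun) -(fineK sfin).
rewrite -!EFinB -!EFinD /= !lee_fin => H1 H2.
by rewrite ler_norml; apply/andP; split; lra.
Qed.
End mixture.

(** * Moments of the Poisson law *)

Section poisson_moments.
Context (R : realType) (lambda : R).
Hypothesis lambda_gt0 : 0 < lambda.
Local Notation p := (poisson_pmf lambda).
Local Open Scope ereal_scope.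

Lemma poisson_pmf_sum : \sum_(n <oo) (p n)%:E = 1.
Proof.
rewrite -(@probability_setT _ _ _ (poisson_prob lambda 0)).
rewrite /= /poisson_prob lambda_gt0 nneseries_esumT => [|n]; last exact: poisson_pmf_ge0.
by [].
Qed.

(** The Stein-Chen identity [E (N g(N - 1)) = lambda E g(N)], which is
    [n p_n = lambda p_(n-1)] summed over [n]; it yields the first two moments. *)
Lemma poisson_pmf_stein (g : nat -> R) : (forall n, 0 <= g n)%R ->
  \sum_(n <oo) (p n * (n%:R * g n.-1))%:E =
  lambda%:E * \sum_(n <oo) (p n * g n)%:E.
Proof.
move=> g0; rewrite nneseries_recl//; last first.
  by move=> n _; rewrite lee_fin !mulr_ge0// poisson_pmf_ge0.
rewrite mul0r mulr0 add0e.
rewrite -nneseriesZl//; last first.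
  by move=> n _; rewrite lee_fin !mulr_ge0// poisson_pmf_ge0.
rewrite -(nneseries_addn 1).
  apply: eq_eseriesr => n _; rewrite -EFinM; congr EFin.
  rewrite /poisson_pmf lambda_gt0 addn1/= exprS factS natrM.
  have n1 : (n.+1%:R : R) != 0%R by rewrite pnatr_eq0.
  have nf : (n`!%:R : R) != 0%R by rewrite pnatr_eq0 -lt0n fact_gt0.
  move: (n.+1%:R : R) n1 (n`!%:R : R) nf => m m0 f f0.
  by field; rewrite m0 f0.
by move=> n; rewrite lee_fin !mulr_ge0// poisson_pmf_ge0.
Qed.

Lemma poisson_pmf_mean : \sum_(n <oo) (p n * n%:R)%:E = lambda%:E.
Proof.
rewrite -[RHS]mule1 -poisson_pmf_sum.
under [in RHS]eq_eseriesr do rewrite -[p _]mulr1.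
rewrite -(@poisson_pmf_stein (fun=> 1%R))//.
by apply: eq_eseriesr => n _; rewrite mulr1.
Qed.

Lemma poisson_pmf_second_moment :
  \sum_(n <oo) (p n * n%:R ^+ 2)%:E = (lambda * (lambda + 1))%:E.
Proof.
have p_ge0 n : (0 <= p n)%R by exact: poisson_pmf_ge0.
transitivity (\sum_(n <oo) (p n * (n%:R * n.-1.+1%:R))%:E).
  apply: eq_eseriesr => -[|n] _; first by rewrite expr0n !mul0r mulr0.
  by rewrite expr2.
rewrite (@poisson_pmf_stein (fun n => n.+1%:R))// EFinM; congr (_ * _).
under eq_eseriesr do rewrite -natr1 mulrDr mulr1 EFinD.
by rewrite nneseriesD ?poisson_pmf_mean ?poisson_pmf_sum// => n _ _;
  rewrite lee_fin ?mulr_ge0.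
Qed.

Lemma poisson_pmf_variance :
  \sum_(n <oo) (p n * (n%:R - lambda) ^+ 2)%:E = lambda%:E.
Proof.
have p_ge0 n : (0 <= p n)%R by exact: poisson_pmf_ge0.
have l0 := ltW lambda_gt0.
set V := LHS.
have : V + (2 * lambda * lambda)%:E =
    (lambda * (lambda + 1))%:E + (lambda ^+ 2)%:E.
  rewrite [in LHS]EFinM -poisson_pmf_mean -nneseriesZl; last first.
    by move=> n _; rewrite lee_fin mulr_ge0.
  rewrite -poisson_pmf_second_moment -[(lambda ^+ 2)%:E]mule1 -poisson_pmf_sum.
  rewrite -nneseriesZl; last by move=> n _; rewrite lee_fin.
  rewrite /V -!nneseriesD.
  - by apply: eq_eseriesr => n _; rewrite -!EFinM -!EFinD; congr EFin; ring.
  - by move=> n _ _; rewrite lee_fin mulr_ge0 ?sqr_ge0.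
  - by move=> n _ _; rewrite -EFinM lee_fin mulr_ge0 ?sqr_ge0.
  - by move=> n _ _; rewrite lee_fin mulr_ge0 ?sqr_ge0.
  - by move=> n _ _; rewrite -EFinM lee_fin !mulr_ge0.
have : V \is a fin_num \/ V = +oo.
  have : 0 <= V by apply: nneseries_ge0 => n _ _; rewrite lee_fin mulr_ge0 ?sqr_ge0.
  by case: V => //; [left|right].
case=> [Vfin|->]; last by rewrite addye.
by rewrite -(fineK Vfin) -!EFinD => -[Veq]; congr EFin; lra.
Qed.

Lemma dist_sqrt_le (x : R) : (0 <= x)%R -> (`|Num.sqrt x - 1| <= `|x - 1|)%R.
Proof.
move=> x0; have -> : (x - 1 = Num.sqrt x ^+ 2 - 1 ^+ 2)%R by rewrite sqr_sqrtr// expr1n.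
by rewrite subr_sqr normrM ler_peMr// ger0_norm ?addr_ge0 ?sqrtr_ge0// lerDr sqrtr_ge0.
Qed.

(** The mean of [|N / lambda - 1|] is bounded by averaging the inequality
    [2 u s <= u ^ 2 + s ^ 2] with [u = |n - lambda|] and [s = sqrt lambda].  This
    gives the same constant as the Cauchy-Schwarz inequality, since the variance
    of [N] is exactly [s ^ 2]. *)
Lemma poisson_sqrt_deviation (a k : R) : (0 <= a)%R -> (0 <= k)%R ->
  \sum_(n <oo) (p n * (a + k * `|Num.sqrt (n%:R / lambda) - 1|))%:E <=
  (a + k / Num.sqrt lambda)%:E.
Proof.
move=> a0 k0; have p_ge0 n : (0 <= p n)%R by exact: poisson_pmf_ge0.
set s := Num.sqrt lambda.
have s0 : (0 < s)%R by rewrite sqrtr_gt0.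
have s0' := ltW s0.
have ls : (lambda = s ^+ 2)%R by rewrite sqr_sqrtr ?ltW.
pose c : R := (k / (2 * s ^+ 3))%R; pose e : R := (a + k / (2 * s))%R.
have c0 : (0 <= c)%R by rewrite divr_ge0 ?mulr_ge0 ?exprn_ge0.
have e0 : (0 <= e)%R by rewrite addr_ge0 ?divr_ge0 ?mulr_ge0.
apply: (@le_trans _ _ (\sum_(n <oo) (c%:E * (p n * (n%:R - lambda) ^+ 2)%:E + e%:E * (p n)%:E))).
  apply: lee_nneseries => n _.
    by rewrite lee_fin mulr_ge0 ?addr_ge0 ?mulr_ge0.
  rewrite -!EFinM -EFinD lee_fin mulrCA (mulrC e) -mulrDr ler_wpM2l//.
  have h1 := dist_sqrt_le (divr_ge0 (ler0n R n) (ltW lambda_gt0)).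
  have h2 : (`|n%:R / lambda - 1| <= ((n%:R - lambda) ^+ 2 / s ^+ 3 + 1 / s) / 2)%R.
    have -> : (n%:R / lambda - 1 = (n%:R - lambda) / s ^+ 2)%R.
      by rewrite ls; field; rewrite gt_eqF.
    rewrite normrM normfV (ger0_norm (sqr_ge0 s)) -(real_normK (num_real (n%:R - lambda)%R)).
    set u := `|n%:R - lambda|%R.
    rewrite -subr_ge0 (_ : _ - _ = (u - s) ^+ 2 / (2 * s ^+ 3))%R; last first.
      by field; rewrite gt_eqF.
    by rewrite divr_ge0 ?sqr_ge0// mulr_ge0// exprn_ge0// ltW.
  have := ler_wpM2l k0 (le_trans h1 h2).
  rewrite (_ : k * (((n%:R - lambda) ^+ 2 / s ^+ 3 + 1 / s) / 2) = c * (n%:R - lambda) ^+ 2 + k / (2 * s))%R.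
    by rewrite /e; lra.
  by rewrite /c; field; rewrite gt_eqF.
rewrite nneseriesD; last 2 first.
- by move=> n _ _; rewrite mule_ge0 ?lee_fin// mulr_ge0 ?sqr_ge0.
- by move=> n _ _; rewrite mule_ge0 ?lee_fin.
rewrite !nneseriesZl; last 2 first.
- by move=> n _; rewrite lee_fin.
- by move=> n _; rewrite lee_fin mulr_ge0 ?sqr_ge0.
rewrite poisson_pmf_variance poisson_pmf_sum mule1 -EFinM -EFinD lee_fin /c /e ls.
by rewrite le_eqVlt; apply/orP; left; apply/eqP; field; rewrite gt_eqF.
Qed.
End poisson_moments.

(** * Partial sums and the random sum *)

Section random_sum.
Context d (T : measurableType d) (R : realType) (P : probability T R).
Variable X : nat -> {RV P >-> R}.

Lemma mutually_independent_ord n : mutually_independent X ->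
  mutually_independent (fun j : 'I_n => X j).
Proof.
move=> indep J A mA.
pose A' k := if insub k is Some i then A i else setT.
have A'E (i : 'I_n) : A' i = A i by rewrite /A' valK.
have := indep [fset (val i) | i in J]%fset A'.
rewrite big_imfset /=; last by move=> i j _ _; exact: val_inj.
rewrite (eq_bigr (fun i : 'I_n => fine (P (X i @^-1` A i)))); last first.
  by move=> i _; rewrite A'E.
move=> <-; last first.
  by move=> _ /imfsetP[i /= iJ ->]; rewrite A'E; exact: mA.
congr (P _); apply/seteqP; split => t tA k /=.
  by move=> /imfsetP[i /= iJ ->]; rewrite A'E; exact: tA.
by move=> kJ; have := tA (val k); rewrite /= A'E; apply; apply/imfsetP; exists k.
Qed.

Lemma sigma_family_scaled_sum c n (B : set R) : measurable B ->
  sigma_family X (scaled_sum c (fun j : 'I_n => X j) @^-1` B).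
Proof.
move=> mB; pose G := \bigcup_i preimage_set_system [set: T] (X i) measurable.
pose TG := g_sigma_algebraType G.
have mX i : measurable_fun [set: TG] (X i : TG -> R).
  by move=> _ C mC; apply: sub_sigma_algebra; exists i => //; exists C.
have : measurable_fun [set: TG] (scaled_sum c (fun j : 'I_n => X j) : TG -> R).
  by apply: measurable_funM => //; apply: measurable_sum => j; exact: mX.
by move=> /(_ measurableT B mB); rewrite setTI.
Qed.

(** The law of the random sum is the mixture of the laws of the partial sums: on
    the event that [N] equals [n], the random sum is the [n]-th partial sum,
    which is measurable for the sigma-algebra of the sequence. *)
Lemma distribution_random_sum (N : {RV P >-> nat}) (p : nat -> R) c A :
  independent_of_family N X -> (forall n, P (N @^-1` [set n]) = (p n)%:E) ->
  measurable A ->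
  (distribution P (scaled_random_sum c N X) A = \sum_(n <oo)
    (p n)%:E * distribution P (scaled_sum c (fun j : 'I_n => X j)) A)%E.
Proof.
move=> indep pE mA; rewrite /distribution /pushforward.
pose F n := N @^-1` [set n] `&` scaled_sum c (fun j : 'I_n => X j) @^-1` A.
have -> : scaled_random_sum c N X @^-1` A = \bigcup_n F n.
  apply/seteqP; split => [t At|t [n _ [/= <-]]//].
  by exists (N t).
rewrite measure_bigcup//=.
- rewrite eseries_mkcond.
  apply: eq_eseriesr => n _; rewrite in_setT /F indep ?pE//.
  exact: sigma_family_scaled_sum.
- move=> n _; apply: measurableI; first exact: measurable_funPTI.
  exact: measurable_funPTI.
- apply/trivIsetP => i j _ _ ij; rewrite -subset0 => t [[/= Ni _] [/= Nj _]].
  by move: ij; rewrite -Ni -Nj eqxx.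
Qed.

(** Equal laws integrate nonnegative functions alike, hence both parts of [f]. *)
Lemma identically_distributed_integral (f : R -> \bar R) i j :
  identically_distributed X -> measurable_fun setT f ->
  (\int[P]_t f (X i t) = \int[P]_t f (X j t))%E.
Proof.
move=> Xid mf.
have ge0E (g : R -> \bar R) : measurable_fun setT g -> (forall x, 0 <= g x)%E ->
    (\int[P]_t g (X i t) = \int[P]_t g (X j t))%E.
  move=> mg g0; have lawE k := @ge0_integral_distribution _ _ _ _ _ P (X k) g mg g0.
  rewrite -[LHS]lawE -[RHS]lawE.
  by apply: eq_measure_integral => A mA _; exact: Xid.
rewrite -[LHS]/(\int[P]_t (f \o X i) t)%E -[RHS]/(\int[P]_t (f \o X j) t)%E.
rewrite (integralE _ _ (f \o X i)) (integralE _ _ (f \o X j)).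
rewrite (funepos_comp f (X i)) (funepos_comp f (X j)).
rewrite (funeneg_comp f (X i)) (funeneg_comp f (X j)).
congr (_ - _)%E; first exact: (ge0E _ (measurable_funepos mf)).
exact: (ge0E _ (measurable_funeneg mf)).
Qed.

Section partial_sums.
Variables (CW sigma xi lambda : R).
Hypotheses (hCW : wasserstein_berry_esseen_constant CW)
  (X_indep : mutually_independent X)
  (X_id : identically_distributed X)
  (X_mean : ('E_P[X 0%N] = 0)%E)
  (sigma_gt0 : 0 < sigma)
  (X_var : ('E_P[fun t => (X 0%N t ^+ 2)%R] = (sigma ^+ 2)%:E)%E)
  (X_third : ('E_P[fun t => (`|X 0%N t| ^+ 3)%R] = xi%:E)%E)
  (lambda_gt0 : 0 < lambda).

(** Here [B = sigma sqrt n], so that [CW B^-3 n xi] is the bound below. *)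
Lemma berry_esseen_iid n : (0 < n)%N ->
  (wasserstein (distribution P (scaled_sum (sigma * Num.sqrt n%:R)^-1
     (fun j : 'I_n => X j))) (normal_law 0 1) <=
   (CW * xi / (sigma ^+ 3 * Num.sqrt n%:R))%:E)%E.
Proof.
move=> n0.
have meanE j : ('E_P[X j] = 0)%E.
  rewrite -X_mean !expectation_def.
  by apply: (identically_distributed_integral (f := EFin)).
have varE j : ('E_P[fun t => (X j t ^+ 2)%R] = (sigma ^+ 2)%:E)%E.
  rewrite -X_var unlock.
  apply: (identically_distributed_integral (f := fun x => (x ^+ 2)%:E)) => //.
  by apply/measurable_EFinP; exact: measurable_funX.
have thirdE j : ('E_P[fun t => (`|X j t| ^+ 3)%R] = xi%:E)%E.
  rewrite -X_third unlock.
  apply: (identically_distributed_integral (f := fun x => (`|x| ^+ 3)%:E)) => //.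
  by apply/measurable_EFinP; apply: measurable_funX; exact: normr_measurable.
have var_gt0 (j : 'I_n) : (0 < 'E_P[fun t => (X j t ^+ 2)%R])%E.
  by rewrite varE lte_fin exprn_gt0.
have third_lty (j : 'I_n) : ('E_P[fun t => (`|X j t| ^+ 3)%R] < +oo)%E.
  by rewrite thirdE ltry.
have := hCW n0 (mutually_independent_ord (n := n) X_indep)
  (fun j : 'I_n => meanE j) var_gt0 third_lty.
have sq0 : 0 < Num.sqrt n%:R :> R by rewrite sqrtr_gt0 ltr0n.
rewrite (eq_bigr (fun=> sigma ^+ 2)) => [|j _]; last by rewrite varE.
have -> : \sum_(j < n) fine 'E_P[fun t => (`|X j t| ^+ 3)%R] = xi *+ n.
  by under eq_bigr do rewrite thirdE/=; rewrite sumr_const card_ord.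
rewrite sumr_const card_ord -[sigma ^+ 2 *+ n]mulr_natr sqrtrM ?sqr_ge0//.
rewrite sqrtr_sqr gtr0_norm//= => /le_trans; apply.
rewrite lee_fin le_eqVlt; apply/orP; left; apply/eqP.
have := sqr_sqrtr (ler0n R n); move: (Num.sqrt _) sq0 => s s0 sE.
rewrite -[xi *+ n]mulr_natr -sE; field.
by rewrite !gt_eqF.
Qed.

(** For [n = 1] the Berry-Esseen bound dominates a distance.  The sign serves for
    [n = 0], where there is no such bound. *)
Lemma berry_esseen_bound_ge0 : 0 <= CW * xi.
Proof.
have W0 : (0 <= wasserstein (distribution P (scaled_sum (sigma * Num.sqrt 1%:R)^-1
    (fun j : 'I_1 => X j))) (normal_law 0 1))%E.
  apply: ereal_sup_ge; exists 0%E => //; exists (cst 0).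
    by apply/lipschitz1P => x y; rewrite subrr normr0.
  by rewrite !integral0_eq// sube0 abse0.
have := le_trans W0 (berry_esseen_iid (n := 1) isT).
by rewrite lee_fin sqrtr1 mulr1 pmulr_lge0// invr_gt0 exprn_gt0.
Qed.

(** The partial sum is close to [N(0, sigma ^ 2 n / lambda)] by the Berry-Esseen
    bound multiplied by the scale [s], in which [n] cancels, and the latter law
    is close to [N(0, sigma ^ 2)] because both are multiples of one standard
    normal variable. *)
Lemma wasserstein_partial_sum n :
  (wasserstein (distribution P (scaled_sum (Num.sqrt lambda)^-1
     (fun j : 'I_n => X j))) (normal_law 0 sigma) <=
   (CW * xi / sigma ^+ 2 / Num.sqrt lambda +
    sigma * Num.sqrt (2 / pi) * `|Num.sqrt (n%:R / lambda) - 1|)%:E)%E.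
Proof.
pose Z : probability R R := normal_law (0 : R) 1.
have Z1 : (first_moment Z < +oo)%E by rewrite first_moment_std_normal ltry.
have sl0 : 0 < Num.sqrt lambda by rewrite sqrtr_gt0.
have zeta0 : 0 <= CW * xi / sigma ^+ 2 / Num.sqrt lambda.
  by rewrite !divr_ge0 ?sqr_ge0 ?berry_esseen_bound_ge0// ltW.
(* [s] is the standard deviation of the [n]-th partial sum once scaled. *)
pose s := sigma * Num.sqrt (n%:R / lambda).
rewrite (@eq_wasserstein _ _ _ (distribution P (scaled_sum (Num.sqrt lambda)^-1
     (fun j : 'I_n => X j))) (distribution Z (dilation sigma)))//; last first.
  by move=> A mA; exact: normal_law_dilation.
have dil1 c : (first_moment (distribution Z (dilation c)) < +oo)%E.
  by rewrite first_moment_dilation first_moment_std_normal -EFinM ltry.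
have Zdist : (wasserstein (distribution Z (dilation s)) (distribution Z (dilation sigma)) <=
  (sigma * Num.sqrt (2 / pi) * `|Num.sqrt (n%:R / lambda) - 1|)%:E)%E.
  apply: (le_trans (wasserstein_dilation_dist s sigma Z1)).
  rewrite first_moment_std_normal -EFinM lee_fin /s -[X in _ - X]mulr1 -mulrBr.
  by rewrite normrM gtr0_norm// mulrAC.
case: n @s Zdist => [|n] s Zdist.
  (* For [n = 0] both the empty sum and [0 * Z] are the constant 0, and the
     comparison of the two multiples of [Z] is the whole bound. *)
  have s0 : s = 0 by rewrite /s mul0r sqrtr0 mulr0.
  rewrite s0 in Zdist.
  rewrite (@eq_wasserstein _ _ _ (distribution Z (dilation 0)) (distribution Z (dilation sigma)))//.
    by apply: (le_trans Zdist); rewrite lee_fin lerDr.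
  move=> A mA; pose A0 U : set U := if 0 \in A then setT else set0.
  have sumE : scaled_sum (Num.sqrt lambda)^-1 (fun j : 'I_0 => X j) @^-1` A = A0 T.
    rewrite -[RHS](@preimage_cst R T 0 A); congr (_ @^-1` A).
    by apply/funext => t; rewrite /scaled_sum big_ord0 mulr0.
  have dilE : dilation 0 @^-1` A = A0 R.
    rewrite -[RHS](@preimage_cst R R 0 A); congr (_ @^-1` A).
    by apply/funext => x; rewrite /dilation mul0r.
  rewrite /distribution /pushforward [LHS](congr1 P sumE) [RHS](congr1 Z dilE) /A0.
  by case: ifP => _; [rewrite (probability_setT P) (probability_setT Z)|rewrite (measure0 P) (measure0 Z)].
set B := sigma * Num.sqrt n.+1%:R.
have B0 : 0 < B by rewrite mulr_gt0// sqrtr_gt0 ltr0n.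
set L := distribution P (scaled_sum B^-1 (fun j : 'I_n.+1 => X j)).
have BE := berry_esseen_iid (n := n.+1) isT; rewrite -/B -/L in BE.
have L1 : (first_moment L < +oo)%E.
  by apply: (first_moment_lty Z1); rewrite (le_lt_trans BE)// ltry.
have s0 : 0 < s by rewrite mulr_gt0// sqrtr_gt0 divr_gt0.
rewrite (@eq_wasserstein _ _ _ (distribution L (dilation s)) (distribution Z (dilation sigma)))//; last first.
  move=> A mA; rewrite /L /distribution /pushforward; congr (P _).
  apply/funext => t; congr (A _); rewrite /= /scaled_sum /dilation mulrA; congr (_ * _).
  rewrite /s sqrtrM// sqrtrV; last exact: ltW.
  rewrite /B; field.
  by rewrite !gt_eqF// sqrtr_gt0 ltr0n.
apply: (@le_trans _ _ (wasserstein (distribution L (dilation s)) (distribution Z (dilation s)) + wasserstein (distribution Z (dilation s)) (distribution Z (dilation sigma))))%E.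
  apply: wasserstein_triangle => //.
  by rewrite first_moment_dilation lte_mul_pinfty.
rewrite EFinD; apply: leeD => //.
apply: (le_trans (wasserstein_dilation s0 L1 Z1)).
apply: (le_trans (lee_wpmul2l _ BE)); first by rewrite lee_fin ltW.
rewrite -EFinM lee_fin le_eqVlt; apply/orP; left; apply/eqP.
rewrite /s sqrtrM// sqrtrV; last exact: ltW.
field.
by rewrite !gt_eqF// sqrtr_gt0 ltr0n.
Qed.

End partial_sums.
End random_sum.

(** * The random sum and the normal law *)

Theorem theorem3p7 (R : realType) (CW : R)
  (hCW : wasserstein_berry_esseen_constant CW)
  (d : measure_display) (T : measurableType d) (P : probability T R)
  (X : nat -> {RV P >-> R}) (N : {RV P >-> nat}) (sigma xi lambda : R)
  (X_indep : mutually_independent X)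
  (X_id : identically_distributed X)
  (X_mean : ('E_P[X 0%N] = 0)%E)
  (sigma_gt0 : 0 < sigma)
  (X_var : ('E_P[fun t => (X 0%N t ^+ 2)%R] = (sigma ^+ 2)%:E)%E)
  (X_third : ('E_P[fun t => (`|X 0%N t| ^+ 3)%R] = xi%:E)%E)
  (lambda_gt0 : 0 < lambda)
  (N_poisson : forall n : nat,
     P (N @^-1` [set n]) = (poisson_pmf lambda n)%:E)
  (N_indep : independent_of_family N X) :
  (wasserstein (distribution P (scaled_random_sum (Num.sqrt lambda)^-1 N X))
     (normal_law 0 sigma)
   <= ((CW * xi / sigma ^+ 2 + sigma * Num.sqrt (2 / pi)) *
       (Num.sqrt lambda)^-1)%:E)%E.
Proof.
have Z1 : (first_moment (normal_law 0 sigma) < +oo)%E.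
  have -> : first_moment (normal_law 0 sigma) =
      first_moment (distribution (normal_law 0 1) (dilation sigma)).
    by apply: eq_measure_integral => A mA _; exact: normal_law_dilation.
  by rewrite first_moment_dilation first_moment_std_normal -EFinM ltry.
have CWxi := berry_esseen_bound_ge0 hCW X_indep X_id X_mean sigma_gt0 X_var X_third.
pose a := CW * xi / sigma ^+ 2 / Num.sqrt lambda.
pose k := sigma * Num.sqrt (2 / pi).
have a0 : 0 <= a by rewrite !divr_ge0 ?sqr_ge0 ?sqrtr_ge0.
have k0 : 0 <= k by rewrite mulr_ge0 ?sqrtr_ge0// ltW.
rewrite mulrDl.
apply: le_trans (poisson_sqrt_deviation lambda_gt0 a0 k0).
apply: (wasserstein_mixture (p := poisson_pmf lambda)
  (mu_ := fun n => distribution P (scaled_sum (Num.sqrt lambda)^-1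
                                     (fun j : 'I_n => X j)))) => //.
- by move=> n; exact: poisson_pmf_ge0.
- exact: poisson_pmf_sum.
- by move=> A mA; exact: distribution_random_sum.
- by move=> n; rewrite addr_ge0// mulr_ge0.
- by move=> n; exact: wasserstein_partial_sum.
Qed.
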